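(* Let $\mathcal{C}$ be a category with finite limits. If $Y$ is an internal group in $\mathcal{C}$ (viewed as an internal monoid), then all split extensions in $\mathsf{Mon}(\mathcal{C})$ over $Y$ are stably strong. In other words, any internal group in $\mathcal{C}$ is a protomodular object of $\mathsf{Mon}(\mathcal{C})$.
   Context: For a category $\mathcal{C}$ with finite products, $\mathsf{Mon}(\mathcal{C})$ denotes the category of internal monoids in $\mathcal{C}$ (with internal monoid morphisms), and $\mathsf{Gp}(\mathcal{C})$ the category of internal groups in $\mathcal{C}$. When $\mathcal{C}$ has finite limits, $\mathsf{Mon}(\mathcal{C})$ is a pointed category with finite limits. In a pointed category $\mathcal{D}$ with finite limits: A split extension over $Y$ is a diagram consisting of morphisms $k\colon K\to X$, $f\colon X\to Y$, $s\colon Y\to X$ such that $k$ is a kernel of $f$ and $f\circ s=1_Y$ (it is not required that $f$ be a cokernel of $k$). A pair of arrows $(k\colon K\to X,\ s\colon Y\to X)$ is jointly extremally epimorphic when, for every monomorphism $m\colon M\to X$ such that both $k$ and $s$ factor through $m$, the morphism $m$ is an isomorphism. A split extension $(k,f,s)$ is strong when $(k,s)$ is jointly extremally epimorphic. The pullback of a split extension $(k,f,s)$ over $Y$ along $g\colon W\to Y$ is the split extension over $W$ given by the pullback projection $\pi_1\colon W\times_Y X\to W$, its section $\langle 1_W, s\circ g\rangle\colon W\to W\times_Y X$, and the kernel of $\pi_1$. A split extension over $Y$ is stably strong when all of its pullbacks along all morphisms $g\colon W\to Y$ are strong. An object $Y$ is protomodular when all split extensions over $Y$ are stably strong. *)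

(* Defs.v *)
From Stdlib Require Import List FinFun ProofIrrelevance.

Set Implicit Arguments.
Unset Strict Implicit.
Unset Printing Implicit Defensive.

Declare Scope cat_scope.
Delimit Scope cat_scope with cat.
Open Scope cat_scope.

Reserved Notation "g ∘ f" (at level 40, left associativity).

Record category : Type := Category {
  ob :> Type;
  hom : ob -> ob -> Type;
  idm : forall X, hom X X;
  comp : forall X Y Z, hom Y Z -> hom X Y -> hom X Z;
  comp_idl : forall X Y (f : hom X Y), comp (idm Y) f = f;
  comp_idr : forall X Y (f : hom X Y), comp f (idm X) = f;
  comp_assoc : forall X Y Z T (h : hom Z T) (g : hom Y Z) (f : hom X Y),
    comp h (comp g f) = comp (comp h g) f
}.
Arguments hom {c} X Y.
Arguments idm {c} X.
Arguments comp {c X Y Z} g f.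
Notation "g ∘ f" := (comp g f) : cat_scope.

Definition monomorphism (C : category) (X Y : C) (m : hom X Y) : Prop :=
  forall (Z : C) (u v : hom Z X), m ∘ u = m ∘ v -> u = v.

Definition isomorphism (C : category) (X Y : C) (f : hom X Y) : Prop :=
  exists g : hom Y X, g ∘ f = idm X /\ f ∘ g = idm Y.

Record functor (J C : category) : Type := Functor {
  fob :> J -> C;
  fmap : forall i j, hom i j -> hom (fob i) (fob j);
  fmap_id : forall i, fmap (idm i) = idm (fob i);
  fmap_comp : forall i j k (b : hom j k) (a : hom i j),
    fmap (b ∘ a) = fmap b ∘ fmap a
}.

Record cone (J C : category) (F : functor J C) : Type := Cone {
  apex : C;
  leg : forall i, hom apex (F i);
  leg_nat : forall i j (a : hom i j), fmap F a ∘ leg i = leg j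
}.
Arguments leg {J C F} c i.

Record limit (J C : category) (F : functor J C) : Type := Limit {
  lim_cone :> cone F;
  lim_lift : forall c : cone F, hom (apex c) (apex lim_cone);
  lim_fac : forall (c : cone F) i, leg lim_cone i ∘ lim_lift c = leg c i;
  lim_uniq : forall (c : cone F) (u : hom (apex c) (apex lim_cone)),
    (forall i, leg lim_cone i ∘ u = leg c i) -> u = lim_lift c
}.

Definition finite_category (J : category) : Prop :=
  Finite J /\ forall i j : J, Finite (hom i j).

(* Limits are given as data, not as mere existence, because the internal monoids
   below are formed with respect to specified products. *)
Definition finite_limits (C : category) : Type :=
  forall J : category, finite_category J -> forall F : functor J C, limit F.

Record finite_products (C : category) : Type := FiniteProducts {
  one : C;
  bang : forall X : C, hom X one;
  bang_uniq : forall (X : C) (f : hom X one), f = bang X;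
  prd : C -> C -> C;
  pr1 : forall A B : C, hom (prd A B) A;
  pr2 : forall A B : C, hom (prd A B) B;
  pair : forall A B X : C, hom X A -> hom X B -> hom X (prd A B);
  pr1_pair : forall (A B X : C) (a : hom X A) (b : hom X B),
    pr1 A B ∘ pair a b = a;
  pr2_pair : forall (A B X : C) (a : hom X A) (b : hom X B),
    pr2 A B ∘ pair a b = b;
  pair_uniq : forall (A B X : C) (a : hom X A) (b : hom X B)
    (u : hom X (prd A B)), pr1 A B ∘ u = a -> pr2 A B ∘ u = b -> u = pair a b
}.
Arguments bang {C} P X : rename.
Arguments prd {C} P A B : rename.
Arguments pr1 {C} P {A B} : rename.
Arguments pr2 {C} P {A B} : rename.
Arguments pair {C} P {A B X} a b : rename.

Definition discrete (T : Type) : category :=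
  @Category T (fun x y => x = y) (fun x => eq_refl)
    (fun x y z g f => eq_trans f g)
    (fun x y f => match f with eq_refl => eq_refl end)
    (fun x y f => match f with eq_refl => eq_refl end)
    (fun x y z t h g f => match h with eq_refl => eq_refl end).

Definition discrete_map (T : Type) (C : category) (F : T -> C) (i j : T)
    (e : i = j) : hom (F i) (F j) :=
  match e in _ = j' return hom (F i) (F j') with eq_refl => idm (F i) end.

Lemma discrete_map_comp (T : Type) (C : category) (F : T -> C) (i j k : T)
    (b : j = k) (a : i = j) :
  discrete_map F (eq_trans a b) = discrete_map F b ∘ discrete_map F a.
Proof. destruct b. simpl. symmetry. apply comp_idl. Qed.

Definition discrete_functor (T : Type) (C : category) (F : T -> C) :
    functor (discrete T) C :=
  @Functor (discrete T) C F (discrete_map F) (fun i => eq_refl)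
    (discrete_map_comp F).

Lemma discrete_leg_nat (T : Type) (C : category) (F : T -> C) (Z : C)
    (l : forall i, hom Z (F i)) (i j : T) (a : i = j) :
  discrete_map F a ∘ l i = l j.
Proof. destruct a. apply comp_idl. Qed.

Definition discrete_cone (T : Type) (C : category) (F : T -> C) (Z : C)
    (l : forall i, hom Z (F i)) : cone (discrete_functor F) :=
  @Cone (discrete T) C (discrete_functor F) Z l (discrete_leg_nat l).

Lemma finite_discrete_empty : finite_category (discrete Empty_set).
Proof. split; [exists nil; intros [] | intros []]. Qed.

Lemma finite_discrete_bool : finite_category (discrete bool).
Proof.
  split.
  - exists (true :: false :: nil). intros []; simpl; auto.
  - intros i j. destruct (Bool.bool_dec i j) as [e | n].
    + exists (e :: nil). intros a. left. exact (proof_irrelevance (i = j) e a).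
    + exists nil. intros a. destruct (n a).
Qed.

Section FiniteProductsOfFiniteLimits.

Variables (C : category) (L : finite_limits C).

Let empty_family (i : Empty_set) : C := match i with end.
Let empty_diagram : functor (discrete Empty_set) C :=
  discrete_functor empty_family.
Let empty_cone (X : C) : cone empty_diagram :=
  @discrete_cone Empty_set C empty_family X (fun i => match i with end).

Let pair_family (A B : C) (i : bool) : C := if i then A else B.
Let pair_diagram (A B : C) : functor (discrete bool) C :=
  discrete_functor (pair_family A B).
Let pair_cone (A B X : C) (a : hom X A) (b : hom X B) :
    cone (pair_diagram A B) :=
  @discrete_cone bool C (pair_family A B) X
    (fun i => if i return hom X (pair_family A B i) then a else b).

Let lim0 := L finite_discrete_empty empty_diagram.
Let lim2 (A B : C) := L finite_discrete_bool (pair_diagram A B).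

Definition finite_products_of_limits : finite_products C.
Proof.
  refine (@FiniteProducts C (apex lim0) (fun X => lim_lift lim0 (empty_cone X))
    _ (fun A B => apex (lim2 A B))
    (fun A B => leg (lim2 A B) true) (fun A B => leg (lim2 A B) false)
    (fun A B X a b => lim_lift (lim2 A B) (pair_cone a b)) _ _ _).
  - intros X f. apply (lim_uniq (c := empty_cone X)). intros [].
  - intros A B X a b. exact (lim_fac (lim2 A B) (pair_cone a b) true).
  - intros A B X a b. exact (lim_fac (lim2 A B) (pair_cone a b) false).
  - intros A B X a b u H1 H2. apply (lim_uniq (c := pair_cone a b)).
    intros []; assumption.
Defined.

End FiniteProductsOfFiniteLimits.

Section InternalMonoids.

Variables (C : category) (P : finite_products C).

Definition prod_mor (A B A' B' : C) (a : hom A A') (b : hom B B') :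
    hom (prd P A B) (prd P A' B') :=
  pair P (a ∘ pr1 P) (b ∘ pr2 P).

Definition prod_assoc (A B D : C) :
    hom (prd P (prd P A B) D) (prd P A (prd P B D)) :=
  pair P (pr1 P ∘ pr1 P) (pair P (pr2 P ∘ pr1 P) (pr2 P)).

Record monoid : Type := Monoid {
  mon_ob : C;
  mon_unit : hom (one P) mon_ob;
  mon_mul : hom (prd P mon_ob mon_ob) mon_ob;
  mon_unitl : mon_mul ∘ pair P (mon_unit ∘ bang P mon_ob) (idm mon_ob)
    = idm mon_ob;
  mon_unitr : mon_mul ∘ pair P (idm mon_ob) (mon_unit ∘ bang P mon_ob)
    = idm mon_ob;
  mon_mulA : mon_mul ∘ prod_mor mon_mul (idm mon_ob)
    = mon_mul ∘ prod_mor (idm mon_ob) mon_mul ∘ prod_assoc mon_ob mon_ob mon_ob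
}.

Record monoid_hom (M N : monoid) : Type := MonoidHom {
  mon_map : hom (mon_ob M) (mon_ob N);
  mon_map_unit : mon_map ∘ mon_unit M = mon_unit N;
  mon_map_mul : mon_map ∘ mon_mul M = mon_mul N ∘ prod_mor mon_map mon_map
}.

Record group : Type := Group {
  grp_monoid :> monoid;
  grp_inv : hom (mon_ob grp_monoid) (mon_ob grp_monoid);
  grp_invl : mon_mul grp_monoid ∘ pair P grp_inv (idm (mon_ob grp_monoid))
    = mon_unit grp_monoid ∘ bang P (mon_ob grp_monoid);
  grp_invr : mon_mul grp_monoid ∘ pair P (idm (mon_ob grp_monoid)) grp_inv
    = mon_unit grp_monoid ∘ bang P (mon_ob grp_monoid)
}.

Lemma monoid_hom_eq (M N : monoid) (f g : monoid_hom M N) :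
  mon_map f = mon_map g -> f = g.
Proof.
  destruct f as [f fu fm], g as [g gu gm]; simpl; intros e; subst g.
  f_equal; apply proof_irrelevance.
Qed.

Lemma pair_comp (A B X Z : C) (a : hom X A) (b : hom X B) (u : hom Z X) :
  pair P a b ∘ u = pair P (a ∘ u) (b ∘ u).
Proof.
  apply pair_uniq; rewrite comp_assoc, ?pr1_pair, ?pr2_pair; reflexivity.
Qed.

Lemma prod_mor_id (A B : C) : prod_mor (idm A) (idm B) = idm (prd P A B).
Proof.
  symmetry; apply pair_uniq; rewrite comp_idl, comp_idr; reflexivity.
Qed.

Lemma prod_mor_comp (A B A' B' A'' B'' : C) (a' : hom A' A'') (b' : hom B' B'')
    (a : hom A A') (b : hom B B') :
  prod_mor (a' ∘ a) (b' ∘ b) = prod_mor a' b' ∘ prod_mor a b.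
Proof.
  unfold prod_mor. rewrite pair_comp, <- !comp_assoc, pr1_pair, pr2_pair.
  reflexivity.
Qed.

Definition monoid_id (M : monoid) : monoid_hom M M.
Proof.
  exists (idm (mon_ob M)).
  - apply comp_idl.
  - rewrite prod_mor_id, comp_idl, comp_idr. reflexivity.
Defined.

Definition monoid_comp (M N Q : monoid) (g : monoid_hom N Q)
    (f : monoid_hom M N) : monoid_hom M Q.
Proof.
  exists (mon_map g ∘ mon_map f).
  - rewrite <- comp_assoc, !mon_map_unit. reflexivity.
  - rewrite <- comp_assoc, mon_map_mul, comp_assoc, mon_map_mul, prod_mor_comp,
      comp_assoc. reflexivity.
Defined.

Definition Mon : category.
Proof.
  refine (@Category monoid monoid_hom monoid_id monoid_comp _ _ _);
    intros; apply monoid_hom_eq; simpl.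
  - apply comp_idl.
  - apply comp_idr.
  - apply comp_assoc.
Defined.

Lemma to_one_eq (X : C) (f g : hom X (one P)) : f = g.
Proof. rewrite (bang_uniq f), (bang_uniq g). reflexivity. Qed.

Definition trivial_monoid : monoid.
Proof.
  refine (@Monoid (one P) (idm _) (bang P _) _ _ _); apply to_one_eq.
Defined.

Definition to_trivial (M : monoid) : monoid_hom M trivial_monoid.
Proof. exists (bang P (mon_ob M)); apply to_one_eq. Defined.

Definition from_trivial (M : monoid) : monoid_hom trivial_monoid M.
Proof.
  exists (mon_unit M); simpl.
  - apply comp_idr.
  - transitivity
      (mon_mul M ∘ pair P (mon_unit M ∘ bang P (mon_ob M)) (idm (mon_ob M))
         ∘ (mon_unit M ∘ bang P (prd P (one P) (one P)))).
    + rewrite mon_unitl, comp_idl. reflexivity.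
    + rewrite <- comp_assoc, pair_comp, comp_idl. unfold prod_mor.
      f_equal. f_equal.
      * rewrite <- comp_assoc. f_equal. apply to_one_eq.
      * f_equal. apply to_one_eq.
Defined.

End InternalMonoids.

Record pointed_category : Type := PointedCategory {
  pcat :> category;
  zero : pcat;
  from_zero : forall X : pcat, hom zero X;
  to_zero : forall X : pcat, hom X zero;
  from_zero_uniq : forall (X : pcat) (f : hom zero X), f = from_zero X;
  to_zero_uniq : forall (X : pcat) (f : hom X zero), f = to_zero X
}.

Definition pointed_Mon (C : category) (P : finite_products C) :
  pointed_category.
Proof.
  refine (@PointedCategory (Mon P) (trivial_monoid P)
    (@from_trivial C P) (@to_trivial C P) _ _);
    intros X f; apply monoid_hom_eq; simpl.
  - rewrite <- (mon_map_unit f); simpl. symmetry. apply comp_idr.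
  - apply to_one_eq.
Defined.

Section SplitExtensions.

Variable D : pointed_category.

Definition zero_mor (X Y : D) : hom X Y := from_zero Y ∘ to_zero X.

Definition is_kernel (K X Y : D) (k : hom K X) (f : hom X Y) : Prop :=
  f ∘ k = zero_mor K Y /\
  forall (Z : D) (h : hom Z X), f ∘ h = zero_mor Z Y ->
    exists! u : hom Z K, k ∘ u = h.

Definition is_pullback (Q W X Y : D) (p1 : hom Q W) (p2 : hom Q X)
    (g : hom W Y) (f : hom X Y) : Prop :=
  g ∘ p1 = f ∘ p2 /\
  forall (Z : D) (a : hom Z W) (b : hom Z X), g ∘ a = f ∘ b ->
    exists! u : hom Z Q, p1 ∘ u = a /\ p2 ∘ u = b.

Definition jointly_extremally_epimorphic (K Y X : D) (k : hom K X)
    (s : hom Y X) : Prop :=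
  forall (M : D) (m : hom M X), monomorphism m ->
    (exists k' : hom K M, m ∘ k' = k) -> (exists s' : hom Y M, m ∘ s' = s) ->
    isomorphism m.

Record split_extension (Y : D) : Type := SplitExtension {
  se_ker : D;
  se_tot : D;
  se_k : hom se_ker se_tot;
  se_f : hom se_tot Y;
  se_s : hom Y se_tot;
  se_kernel : is_kernel se_k se_f;
  se_section : se_f ∘ se_s = idm Y
}.

Definition strong (Y : D) (E : split_extension Y) : Prop :=
  jointly_extremally_epimorphic (se_k E) (se_s E).

(* [E'] is a pullback of [E] along [g]: the total object of [E'] is a pullback
   of [g] and [se_f E], with projections [se_f E'] and [p2].  Together with
   [se_section E'], the last equation says that [se_s E'] is the morphism
   <1, se_s E ∘ g>; and [se_k E'] is a kernel of [se_f E'] by [se_kernel]. *)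
Definition is_pullback_extension (Y : D) (E : split_extension Y) (W : D)
    (g : hom W Y) (E' : split_extension W) : Prop :=
  exists p2 : hom (se_tot E') (se_tot E),
    is_pullback (se_f E') p2 g (se_f E) /\ p2 ∘ se_s E' = se_s E ∘ g.

(* Pullbacks and kernels being determined up to isomorphism only, the
   condition is imposed on each of them. *)
Definition stably_strong (Y : D) (E : split_extension Y) : Prop :=
  forall (W : D) (g : hom W Y) (E' : split_extension W),
    is_pullback_extension E g E' -> strong E'.

Definition protomodular_object (Y : D) : Prop :=
  forall E : split_extension Y, stably_strong E.

End SplitExtensions.

(* Main.v *)
Require Import Defs.
From Stdlib Require Import List Bool Eqdep_dec.

Set Implicit Arguments.
Unset Strict Implicit.
Unset Printing Implicit Defensive.

(** In the category of sets the statement is elementary.  Let [(k, f, s)] be a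
split extension of monoids over a group [Y], pulled back along [g : W -> Y].  An
element of the pullback is a pair [(w, x)] with [g w = f x], and
<<
    (w, x) = (1, x * s (g w)^-1) * (w, s (g w)),
>>
where [s (g w)] is invertible because [s] carries the inverse of [g w] to an
inverse.  The first factor lies in the kernel of the projection to [W], since
[f (x * s (g w)^-1) = f x * (g w)^-1 = 1], and the second factor is the image of
[w] under the section.  So every element is a kernel element times a value of
the section, and a submonoid containing both is everything.

The same computation is made in a category [C] with finite limits by means of
generalized elements, the morphisms [Z -> X] of [C]: those with values in an
internal monoid form an ordinary monoid, and internal monoid morphisms act on
them by monoid morphisms.  What has to be supplied is that a pullback, a kernel
or a monomorphism in [Mon C] can be tested on generalized elements, which are
morphisms of [C] and not of [Mon C].  All three are cases of the fact that the
forgetful functor from [Mon C] to [C] preserves pullbacks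
([forgetful_preserves_pullbacks]): the pullback computed in [C] carries a monoid
structure ([pullback_in_Mon]), and it is isomorphic to any other pullback in
[Mon C].

The decomposition of the generic element, the identity of the pullback, then
provides a section in [C] of any monomorphism of monoids through which the
kernel and the section factor ([kernel_section_decomposition]).  A monomorphism
of monoids with a section in [C] is an isomorphism of monoids
([mono_with_section_iso]). *)

(** * Pullbacks from finite limits *)

Definition pullback_square (C : category) (Q W X Y : C) (p1 : hom Q W)
    (p2 : hom Q X) (g : hom W Y) (f : hom X Y) : Prop :=
  g ∘ p1 = f ∘ p2 /\
  forall (Z : C) (a : hom Z W) (b : hom Z X), g ∘ a = f ∘ b ->
    exists! u : hom Z Q, p1 ∘ u = a /\ p2 ∘ u = b.

Definition has_pullbacks (C : category) : Prop :=
  forall (W X Y : C) (g : hom W Y) (f : hom X Y),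
    exists (Q : C) (p1 : hom Q W) (p2 : hom Q X), pullback_square p1 p2 g f.

Lemma pullback_jointly_monic (C : category) (Q W X Y : C) (p1 : hom Q W)
    (p2 : hom Q X) (g : hom W Y) (f : hom X Y) :
  pullback_square p1 p2 g f ->
  forall (Z : C) (u v : hom Z Q),
    p1 ∘ u = p1 ∘ v -> p2 ∘ u = p2 ∘ v -> u = v.
Proof.
  intros [sq univ] Z u v e1 e2.
  destruct (univ Z (p1 ∘ v) (p2 ∘ v)) as [t [_ uniq]].
  - rewrite !comp_assoc, sq. reflexivity.
  - rewrite <- (uniq u), <- (uniq v); auto.
Qed.

Inductive cospan_ob : Type := left_foot | right_foot | tip.

Definition cospan_le (i j : cospan_ob) : bool :=
  match i, j with
  | left_foot, left_foot | right_foot, right_foot | _, tip => true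
  | _, _ => false
  end.

Lemma cospan_le_refl (i : cospan_ob) : cospan_le i i = true.
Proof. destruct i; reflexivity. Qed.

Lemma cospan_le_trans (i j k : cospan_ob) :
  cospan_le j k = true -> cospan_le i j = true -> cospan_le i k = true.
Proof. destruct i, j, k; simpl; congruence. Qed.

Lemma bool_eq_irrelevance (a b : bool) (p q : a = b) : p = q.
Proof. apply UIP_dec, bool_dec. Qed.

(** The shape of a cospan is a poset.  Its order is boolean, so that each
hom-type has at most one element and a diagram can be defined by computing on
its two indices. *)
Definition cospan : category.
Proof.
  refine (@Category cospan_ob (fun i j => cospan_le i j = true) cospan_le_refl
    cospan_le_trans _ _ _); intros; apply bool_eq_irrelevance.
Defined.

Lemma finite_cospan : finite_category cospan.
Proof.
  split.
  - exists (left_foot :: right_foot :: tip :: nil). intros []; simpl; auto.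
  - intros i j. destruct (bool_dec (cospan_le i j) true) as [e | n].
    + exists (e :: nil). intros a. left. apply bool_eq_irrelevance.
    + exists nil. intros a. destruct (n a).
Qed.

Section CospanDiagram.

Variables (C : category) (W X Y : C) (g : hom W Y) (f : hom X Y).

Definition cospan_fob (i : cospan_ob) : C :=
  match i with left_foot => W | right_foot => X | tip => Y end.

Definition cospan_fmap (i j : cospan_ob) :
    cospan_le i j = true -> hom (cospan_fob i) (cospan_fob j) :=
  match i, j return cospan_le i j = true -> hom (cospan_fob i) (cospan_fob j)
  with
  | left_foot, left_foot => fun _ => idm W
  | right_foot, right_foot => fun _ => idm X
  | tip, tip => fun _ => idm Y
  | left_foot, tip => fun _ => g
  | right_foot, tip => fun _ => f
  | _, _ => fun e => False_rect _ (diff_false_true e)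
  end.

Definition cospan_diagram : functor cospan C.
Proof.
  refine (@Functor cospan C cospan_fob cospan_fmap _ _).
  - intros []; reflexivity.
  - intros [] [] [] b a; try discriminate b; try discriminate a; simpl;
      rewrite ?comp_idl, ?comp_idr; reflexivity.
Defined.

Definition cospan_leg (Z : C) (a : hom Z W) (b : hom Z X) (i : cospan_ob) :
    hom Z (cospan_fob i) :=
  match i with left_foot => a | right_foot => b | tip => g ∘ a end.

Definition cospan_cone (Z : C) (a : hom Z W) (b : hom Z X)
    (e : g ∘ a = f ∘ b) : cone cospan_diagram.
Proof.
  refine (@Cone cospan C cospan_diagram Z (cospan_leg a b) _).
  intros [] [] h; try discriminate h; simpl; rewrite ?comp_idl; auto.
Defined.

End CospanDiagram.

Lemma finite_limits_has_pullbacks (C : category) :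
  finite_limits C -> has_pullbacks C.
Proof.
  intros L W X Y g f.
  pose (lim := L cospan finite_cospan (cospan_diagram g f)).
  pose proof (leg_nat lim (i := left_foot) (j := tip) eq_refl) as el.
  pose proof (leg_nat lim (i := right_foot) (j := tip) eq_refl) as er.
  exists (apex lim), (leg lim left_foot), (leg lim right_foot). split.
  - exact (eq_trans el (eq_sym er)).
  - intros Z a b e. exists (lim_lift lim (cospan_cone e)). split.
    + split; [exact (lim_fac lim (cospan_cone e) left_foot)
             | exact (lim_fac lim (cospan_cone e) right_foot)].
    + intros u [e1 e2]. symmetry. apply (lim_uniq (c := cospan_cone e)).
      intros []; simpl; [exact e1 | exact e2 |].
      rewrite <- e1. simpl in el. rewrite <- el. symmetry. apply comp_assoc.
Qed.

Section Monoids.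

Variables (C : category) (P : finite_products C).

(** * Generalized elements of internal monoids *)

Section Elements.

Variable M : monoid P.

Definition elt_one (Z : C) : hom Z (mon_ob M) := mon_unit M ∘ bang P Z.

Definition elt_mul (Z : C) (a b : hom Z (mon_ob M)) : hom Z (mon_ob M) :=
  mon_mul M ∘ pair P a b.

Lemma elt_one_comp (Z Z' : C) (u : hom Z' Z) : elt_one Z ∘ u = elt_one Z'.
Proof. unfold elt_one. rewrite <- comp_assoc. f_equal. apply to_one_eq. Qed.

Lemma elt_mul_comp (Z Z' : C) (a b : hom Z (mon_ob M)) (u : hom Z' Z) :
  elt_mul a b ∘ u = elt_mul (a ∘ u) (b ∘ u).
Proof. unfold elt_mul. rewrite <- comp_assoc, pair_comp. reflexivity. Qed.

Lemma elt_mul1l (Z : C) (a : hom Z (mon_ob M)) : elt_mul (elt_one Z) a = a.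
Proof.
  transitivity (elt_mul (elt_one _) (idm (mon_ob M)) ∘ a).
  - rewrite elt_mul_comp, elt_one_comp, comp_idl. reflexivity.
  - unfold elt_mul, elt_one. rewrite mon_unitl. apply comp_idl.
Qed.

Lemma elt_mul1r (Z : C) (a : hom Z (mon_ob M)) : elt_mul a (elt_one Z) = a.
Proof.
  transitivity (elt_mul (idm (mon_ob M)) (elt_one _) ∘ a).
  - rewrite elt_mul_comp, elt_one_comp, comp_idl. reflexivity.
  - unfold elt_mul, elt_one. rewrite mon_unitr. apply comp_idl.
Qed.

End Elements.

Lemma prod_mor_pair (A B A' B' Z : C) (a : hom A A') (b : hom B B')
    (x : hom Z A) (y : hom Z B) :
  prod_mor P a b ∘ pair P x y = pair P (a ∘ x) (b ∘ y).
Proof.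
  unfold prod_mor. rewrite pair_comp, <- !comp_assoc, pr1_pair, pr2_pair.
  reflexivity.
Qed.

Lemma prod_assoc_pair (A B D Z : C) (x : hom Z A) (y : hom Z B) (z : hom Z D) :
  prod_assoc P A B D ∘ pair P (pair P x y) z = pair P x (pair P y z).
Proof.
  unfold prod_assoc.
  rewrite !pair_comp, <- !comp_assoc, !pr1_pair, !pr2_pair. reflexivity.
Qed.

Lemma elt_mulA (M : monoid P) (Z : C) (a b c : hom Z (mon_ob M)) :
  elt_mul (elt_mul a b) c = elt_mul a (elt_mul b c).
Proof.
  pose proof (f_equal (fun h => h ∘ pair P (pair P a b) c) (mon_mulA M)) as e.
  simpl in e.
  rewrite <- !comp_assoc, prod_assoc_pair, !prod_mor_pair, !comp_idl in e.
  exact e.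
Qed.

Section HomElements.

Variables (M N : monoid P) (h : monoid_hom M N).

Lemma hom_elt_one (Z : C) : mon_map h ∘ elt_one M Z = elt_one N Z.
Proof. unfold elt_one. rewrite comp_assoc, mon_map_unit. reflexivity. Qed.

Lemma hom_elt_mul (Z : C) (a b : hom Z (mon_ob M)) :
  mon_map h ∘ elt_mul a b = elt_mul (mon_map h ∘ a) (mon_map h ∘ b).
Proof.
  unfold elt_mul. rewrite comp_assoc, mon_map_mul, <- comp_assoc, prod_mor_pair.
  reflexivity.
Qed.

End HomElements.

Lemma elt_mulV (G : group P) (Z : C) (a : hom Z (mon_ob G)) :
  elt_mul a (grp_inv G ∘ a) = elt_one G Z.
Proof.
  pose proof (f_equal (fun h => h ∘ a) (grp_invr G)) as e. simpl in e.
  rewrite <- !comp_assoc, pair_comp, comp_idl in e.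
  unfold elt_mul, elt_one. rewrite e. f_equal. apply to_one_eq.
Qed.

Lemma elt_mulVl (G : group P) (Z : C) (a : hom Z (mon_ob G)) :
  elt_mul (grp_inv G ∘ a) a = elt_one G Z.
Proof.
  pose proof (f_equal (fun h => h ∘ a) (grp_invl G)) as e. simpl in e.
  rewrite <- !comp_assoc, pair_comp, comp_idl in e.
  unfold elt_mul, elt_one. rewrite e. f_equal. apply to_one_eq.
Qed.

(** * The forgetful functor preserves pullbacks *)

Section ProductSubmonoid.

Variables (M N : monoid P) (Q : C).
Variables (p : hom Q (mon_ob M)) (q : hom Q (mon_ob N)).
Variables (e : hom (one P) Q) (mu : hom (prd P Q Q) Q).

Hypothesis pq_monic : forall (Z : C) (u v : hom Z Q),
  p ∘ u = p ∘ v -> q ∘ u = q ∘ v -> u = v.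
Hypothesis p_unit : p ∘ e = mon_unit M.
Hypothesis q_unit : q ∘ e = mon_unit N.
Hypothesis p_mul : p ∘ mu = mon_mul M ∘ prod_mor P p p.
Hypothesis q_mul : q ∘ mu = mon_mul N ∘ prod_mor P q q.

Lemma p_mul_pair (Z : C) (a b : hom Z Q) :
  p ∘ (mu ∘ pair P a b) = elt_mul (p ∘ a) (p ∘ b).
Proof.
  rewrite comp_assoc, p_mul, <- comp_assoc, prod_mor_pair. reflexivity.
Qed.

Lemma q_mul_pair (Z : C) (a b : hom Z Q) :
  q ∘ (mu ∘ pair P a b) = elt_mul (q ∘ a) (q ∘ b).
Proof.
  rewrite comp_assoc, q_mul, <- comp_assoc, prod_mor_pair. reflexivity.
Qed.

(** A subobject of a product of two monoids that is closed under the operations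
inherits the monoid laws, because they are equations that can be checked after
composing with the two projections. *)
Definition product_submonoid : monoid P.
Proof.
  refine (@Monoid C P Q e mu _ _ _).
  - apply pq_monic; [rewrite p_mul_pair | rewrite q_mul_pair];
      rewrite comp_assoc, ?p_unit, ?q_unit, comp_idr; apply elt_mul1l.
  - apply pq_monic; [rewrite p_mul_pair | rewrite q_mul_pair];
      rewrite comp_assoc, ?p_unit, ?q_unit, comp_idr; apply elt_mul1r.
  - rewrite <- comp_assoc. unfold prod_assoc. rewrite prod_mor_pair.
    unfold prod_mor. rewrite !comp_idl.
    apply pq_monic; [rewrite !p_mul_pair | rewrite !q_mul_pair];
      rewrite (comp_assoc _ mu), ?p_mul, ?q_mul, <- comp_assoc;
      unfold prod_mor; rewrite pair_comp, <- !comp_assoc; apply elt_mulA.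
Defined.

Definition product_submonoid_fst : monoid_hom product_submonoid M :=
  @MonoidHom C P product_submonoid M p p_unit p_mul.

Definition product_submonoid_snd : monoid_hom product_submonoid N :=
  @MonoidHom C P product_submonoid N q q_unit q_mul.

End ProductSubmonoid.

Hypothesis C_pullbacks : has_pullbacks C.

(** The unit and the multiplication on the pullback formed in [C] are induced by
those of the two feet.  A morphism of [C] into it that is compatible with the
operations after both projections is compatible with them, hence the universal
property in [Mon P]. *)
Lemma pullback_in_Mon (W X Y : Mon P) (g : hom W Y) (f : hom X Y) :
  exists (Q : Mon P) (p1 : hom Q W) (p2 : hom Q X),
    pullback_square p1 p2 g f /\
    pullback_square (mon_map p1) (mon_map p2) (mon_map g) (mon_map f).
Proof.
  destruct (C_pullbacks (mon_map g) (mon_map f)) as [Q [p1 [p2 pb]]].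
  pose proof (pullback_jointly_monic pb) as jm.
  pose proof pb as [sq univ].
  destruct (univ (one P) (mon_unit W) (mon_unit X)) as [e [[e1 e2] _]].
  { rewrite !mon_map_unit. reflexivity. }
  destruct (univ (prd P Q Q) (mon_mul W ∘ prod_mor P p1 p1)
    (mon_mul X ∘ prod_mor P p2 p2)) as [mu [[mu1 mu2] _]].
  { rewrite !comp_assoc, !mon_map_mul, <- !comp_assoc, <- !prod_mor_comp, sq.
    reflexivity. }
  exists (product_submonoid jm e1 e2 mu1 mu2).
  exists (product_submonoid_fst jm e1 e2 mu1 mu2).
  exists (product_submonoid_snd jm e1 e2 mu1 mu2).
  split; [| exact pb]. split.
  - apply monoid_hom_eq. exact sq.
  - intros Z a b ab.
    destruct (univ (mon_ob Z) (mon_map a) (mon_map b)) as [u [[u1 u2] _]].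
    { exact (f_equal (@mon_map _ _ _ _) ab). }
    unshelve eexists (@MonoidHom C P Z (product_submonoid jm e1 e2 mu1 mu2)
      u _ _); simpl.
    + apply jm; rewrite comp_assoc, ?u1, ?u2, mon_map_unit; auto.
    + apply jm; rewrite !comp_assoc, ?u1, ?u2, ?mu1, ?mu2, mon_map_mul,
        <- comp_assoc, <- prod_mor_comp, ?u1, ?u2; reflexivity.
    + split.
      * split; apply monoid_hom_eq; assumption.
      * intros v [v1 v2]. apply monoid_hom_eq. simpl.
        apply jm; [rewrite u1, <- v1 | rewrite u2, <- v2]; reflexivity.
Qed.

(** Two pullbacks in [Mon P] are isomorphic, and one of them lies over a
pullback in [C]. *)
Lemma forgetful_preserves_pullbacks (Q W X Y : Mon P) (p1 : hom Q W)
    (p2 : hom Q X) (g : hom W Y) (f : hom X Y) :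
  pullback_square p1 p2 g f ->
  pullback_square (mon_map p1) (mon_map p2) (mon_map g) (mon_map f).
Proof.
  intros pb.
  destruct (pullback_in_Mon g f) as [Q' [q1 [q2 [pb' pbC]]]].
  destruct (proj2 pb Q' q1 q2 (proj1 pb')) as [v [[v1 v2] _]].
  destruct (proj2 pb' Q p1 p2 (proj1 pb)) as [w [[w1 w2] _]].
  assert (vw : v ∘ w = idm Q).
  { apply (pullback_jointly_monic pb);
      rewrite comp_assoc, ?v1, ?v2, ?w1, ?w2, comp_idr; reflexivity. }
  apply (f_equal (@mon_map _ _ _ _)) in v1, v2, w1, w2, vw.
  simpl in v1, v2, w1, w2, vw.
  split; [exact (f_equal (@mon_map _ _ _ _) (proj1 pb)) |].
  intros Z a b ab.
  destruct (proj2 pbC Z a b ab) as [u [[u1 u2] _]].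
  exists (mon_map v ∘ u). split.
  - split; rewrite comp_assoc, ?v1, ?v2; assumption.
  - intros t [t1 t2].
    rewrite <- (comp_idl t), <- vw, <- comp_assoc. f_equal.
    apply (pullback_jointly_monic pbC);
      rewrite comp_assoc, ?w1, ?w2, ?u1, ?u2; auto.
Qed.

(** A morphism is monic when it has the identities as a kernel pair, which is a
statement about a pullback.  Monomorphisms are therefore preserved along with
pullbacks. *)
Lemma forgetful_preserves_monos (M N : Mon P) (m : hom M N) :
  monomorphism m -> monomorphism (mon_map m).
Proof.
  intros mono.
  assert (pb : pullback_square (idm M) (idm M) m m).
  { split; [reflexivity |].
    intros Z a b ab. exists a. split.
    - rewrite comp_idl. split; [reflexivity | exact (mono Z a b ab)].
    - intros u [u1 _]. rewrite <- u1. apply comp_idl. }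
  intros Z u v uv.
  destruct (proj2 (forgetful_preserves_pullbacks pb) Z u v uv)
    as [t [[t1 t2] _]].
  rewrite <- t1, <- t2. reflexivity.
Qed.

(** A kernel is a pullback along the morphism from the zero object.  As the
underlying object of the latter is terminal in [C], the only condition on a
generalized element for factoring through the kernel is that its image be the
unit. *)
Lemma kernel_elements (K X Y : pointed_Mon P) (k : hom K X) (f : hom X Y) :
  is_kernel k f ->
  forall (Z : C) (a : hom Z (mon_ob X)), mon_map f ∘ a = elt_one Y Z ->
    exists u : hom Z (mon_ob K), mon_map k ∘ u = a.
Proof.
  intros [fk univ] Z a fa.
  assert (pb : pullback_square (C := Mon P) (to_zero K) k (from_zero Y) f).
  { split; [symmetry; exact fk |].
    intros T z h zh.
    destruct (univ T h) as [u [ku uniq]].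
    { rewrite (to_zero_uniq (p := pointed_Mon P) z) in zh.
      symmetry. exact zh. }
    exists u. split.
    - split; [| exact ku].
      exact (eq_trans (to_zero_uniq (p := pointed_Mon P) _)
        (eq_sym (to_zero_uniq (p := pointed_Mon P) z))).
    - intros t [_ kt]. exact (uniq t kt). }
  destruct (proj2 (forgetful_preserves_pullbacks pb) Z (bang P Z) a)
    as [u [[_ ku] _]].
  { symmetry. exact fa. }
  exists u. exact ku.
Qed.

(** * Split extensions over an internal group *)

(** The section is compatible with the operations because the monomorphism is,
and can be cancelled. *)
Lemma mono_with_section_iso (M N : Mon P) (m : hom M N)
    (j : hom (mon_ob N) (mon_ob M)) :
  monomorphism m -> mon_map m ∘ j = idm (mon_ob N) -> isomorphism m.
Proof.
  intros mono mj. apply forgetful_preserves_monos in mono.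
  unshelve eexists (@MonoidHom C P N M j _ _).
  - apply mono. rewrite comp_assoc, mj, comp_idl, mon_map_unit. reflexivity.
  - apply mono.
    rewrite !comp_assoc, mj, comp_idl, mon_map_mul, <- comp_assoc,
      <- prod_mor_comp, mj, prod_mor_id, comp_idr. reflexivity.
  - split; apply monoid_hom_eq; simpl; [| exact mj].
    apply mono. rewrite comp_assoc, mj, comp_idl, comp_idr. reflexivity.
Qed.

(** This is the decomposition [(w, x) = (1, x * s (g w)^-1) * (w, s (g w))] of
the generic element of the pullback.  The morphism [r] is [x * s (g w)^-1], and
[t] is the first factor, which factors through [k'] as its projection to [W]
is trivial. *)
Lemma kernel_section_decomposition (Y : group P) (W X X' K' : monoid P)
    (g : monoid_hom W Y) (f : monoid_hom X Y) (s : monoid_hom Y X)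
    (f' : monoid_hom X' W) (s' : monoid_hom W X') (k' : monoid_hom K' X')
    (p : monoid_hom X' X) :
  pullback_square (mon_map f') (mon_map p) (mon_map g) (mon_map f) ->
  mon_map f ∘ mon_map s = idm (mon_ob Y) ->
  mon_map f' ∘ mon_map s' = idm (mon_ob W) ->
  mon_map p ∘ mon_map s' = mon_map s ∘ mon_map g ->
  (forall (Z : C) (a : hom Z (mon_ob X')), mon_map f' ∘ a = elt_one W Z ->
    exists u : hom Z (mon_ob K'), mon_map k' ∘ u = a) ->
  exists u : hom (mon_ob X') (mon_ob K'),
    elt_mul (mon_map k' ∘ u) (mon_map s' ∘ mon_map f') = idm (mon_ob X').
Proof.
  intros pb fs fs' ps ker.
  pose proof (pullback_jointly_monic pb) as jm.
  destruct pb as [sq univ].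
  set (y := mon_map g ∘ mon_map f').
  set (r := elt_mul (mon_map p) (mon_map s ∘ (grp_inv Y ∘ y))).
  destruct (univ (mon_ob X') (elt_one W (mon_ob X')) r) as [t [[t1 t2] _]].
  { unfold r.
    rewrite hom_elt_one, hom_elt_mul, <- sq, (comp_assoc _ (mon_map s)), fs,
      comp_idl.
    symmetry. apply elt_mulV. }
  destruct (ker (mon_ob X') t t1) as [u ku].
  exists u. rewrite ku. apply jm; rewrite hom_elt_mul, comp_idr, !comp_assoc.
  - rewrite t1, fs', comp_idl. apply elt_mul1l.
  - rewrite t2, ps. unfold r.
    rewrite <- (comp_assoc _ (mon_map g)), elt_mulA, <- hom_elt_mul.
    fold y. rewrite elt_mulVl, hom_elt_one. apply elt_mul1r.
Qed.

(** Replacing [k'] and [s'] by their factorizations through the monomorphism [m]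
turns the decomposition of the generic element into a section of [m]. *)
Theorem group_protomodular (Y : group P) :
  protomodular_object (D := pointed_Mon P) (grp_monoid Y).
Proof.
  intros E W g E' [p [pb ps]] M m mono [k' mk] [s' ms].
  destruct (@kernel_section_decomposition Y W (se_tot E) (se_tot E') (se_ker E')
    g (se_f E) (se_s E) (se_f E') (se_s E') (se_k E') p
    (forgetful_preserves_pullbacks pb)
    (f_equal (@mon_map _ _ _ _) (se_section E))
    (f_equal (@mon_map _ _ _ _) (se_section E'))
    (f_equal (@mon_map _ _ _ _) ps)
    (kernel_elements (se_kernel E'))) as [u dec].
  apply (@mono_with_section_iso M (se_tot E') m
    (elt_mul (mon_map k' ∘ u) (mon_map s' ∘ mon_map (se_f E'))) mono).
  rewrite <- mk, <- ms in dec. simpl in dec. rewrite <- !comp_assoc in dec.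
  refine (eq_trans (hom_elt_mul m _ _) dec).
Qed.

End Monoids.

Theorem theorem2p4 (C : category) (L : finite_limits C)
    (Y : group (finite_products_of_limits L)) :
  protomodular_object (D := pointed_Mon (finite_products_of_limits L))
    (grp_monoid Y).
Proof.
  exact (@group_protomodular C (finite_products_of_limits L)
    (finite_limits_has_pullbacks L) Y).
Qed.
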